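(* Let $(\mathbb{X},(-)^\dagger,\iota)$ be an inner product category. For $f:A\to B$ let $f^*:B\to A$ be the inner adjoint of $f$. Then $(\mathbb{X},(-)^* )$, with $A^*=A$ on objects, is a dagger category.
   Context: Composition is written in diagrammatic order: $fg$ means first $f$, then $g$. An involutive category $(\mathbb{X},(-)^\dagger,\iota)$ is a category $\mathbb{X}$ with a functor $(-)^\dagger:\mathbb{X}^{\mathrm{op}}\to\mathbb{X}$ and a natural isomorphism $\iota_X:X\to X^{\dagger\dagger}$ such that $\iota_{X^\dagger}(\iota_X)^\dagger=1_{X^\dagger}$. A dagger category is an involutive category with $X^\dagger=X$ on objects and $\iota$ the identity, i.e. a category with an identity-on-objects contravariant functor which is its own inverse. An inner product category is an involutive category with a combinator assigning to each pair $f:A\to X$, $g:B\to X$ a map $\langle f|g\rangle:A\to B^\dagger$ satisfying the axioms below, where for $h:X\to A$, $k:X\to B$ the dual inner product is $\langle h|k\rangle^\iota := \iota_{A^\dagger}\,\langle k^\dagger|h^\dagger\rangle^\dagger\,\iota_B^{-1}:A^\dagger\to B$: [IP.1] $\langle hf|kg\rangle = h\langle f|g\rangle k^\dagger$ for $f:A\to X$, $g:B\to X$, $h:Y\to A$, $k:Z\to B$; [IP.2](a) $\iota_A\langle f^\dagger|g^\dagger\rangle^\iota=\langle f|g\rangle$ and (b) $\iota_B\langle f|g\rangle^\dagger=\langle g|f\rangle$ for $f:A\to X$, $g:B\to X$; [IP.3] $\langle f|g\rangle\langle h|k\rangle^\iota = fk$ for $f:A\to X$, $g:B\to X$, $h,k:X\to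 B$ with $hg=1_X$; [IP.4] $\langle f|g\rangle^\iota\langle h|k\rangle=(kf)^\dagger$ for $f:A\to Z$, $g:A\to X$, $h,k:X\to A$ with $gh=1_A$. The inner adjoint of $f:A\to B$ is the unique map $f^*:B\to A$ such that $\langle xf|y\rangle=\langle x|yf^*\rangle$ for all maps $x$ with codomain $A$ and $y$ with codomain $B$. It exists and is given by $f^*=\varphi_Bf^\dagger\varphi_A^{-1}$, where $\varphi_A:=\langle 1_A|1_A\rangle:A\to A^\dagger$, which is an isomorphism. *)

(* Defs.v *)
From mathcomp Require Import ssreflect.

Set Implicit Arguments.
Unset Strict Implicit.
Unset Printing Implicit Defensive.

Declare Scope cat_scope.
Local Open Scope cat_scope.

Reserved Notation "f ;; g" (at level 50, left associativity).

(** Composition is diagrammatic: [f ;; g] is first [f], then [g]. *)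
Record category := Category {
  obj :> Type;
  hom : obj -> obj -> Type;
  idm : forall A, hom A A;
  comp : forall A B C, hom A B -> hom B C -> hom A C
    where "f ;; g" := (comp f g);
  comp1m : forall A B (f : hom A B), idm A ;; f = f;
  compm1 : forall A B (f : hom A B), f ;; idm B = f;
  compA : forall A B C D (f : hom A B) (g : hom B C) (h : hom C D),
    f ;; (g ;; h) = (f ;; g) ;; h }.

Arguments hom {c} A B.
Arguments idm {c} A.
Arguments comp {c A B C} f g.

Notation "f ;; g" := (comp f g) : cat_scope.

(** [dobj] and [dag] are the action of the functor [X^op -> X] on objects and
    on maps; [iota_inv] is the inverse of [iota]. *)
Record involutive_category := InvolutiveCategory {
  icat :> category;
  dobj : icat -> icat;
  dag : forall A B : icat, hom A B -> hom (dobj B) (dobj A);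
  iota : forall A : icat, hom A (dobj (dobj A));
  iota_inv : forall A : icat, hom (dobj (dobj A)) A;
  dag_id : forall A : icat, dag (idm A) = idm (dobj A);
  dag_comp : forall (A B C : icat) (f : hom A B) (g : hom B C),
    dag (f ;; g) = dag g ;; dag f;
  iota_natural : forall (A B : icat) (f : hom A B),
    f ;; iota B = iota A ;; dag (dag f);
  iotaK : forall A : icat, iota A ;; iota_inv A = idm A;
  iota_invK : forall A : icat, iota_inv A ;; iota A = idm (dobj (dobj A));
  iota_dag : forall A : icat, iota (dobj A) ;; dag (iota A) = idm (dobj A) }.

Arguments dobj {i} A.
Arguments dag {i A B} f.
Arguments iota {i} A.
Arguments iota_inv {i} A.

Section InnerProduct.

Variable X : involutive_category.

Definition ip_combinator :=
  forall A B Z : X, hom A Z -> hom B Z -> hom A (dobj B).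

Definition dual_ip (ip : ip_combinator) (Z A B : X)
    (h : hom Z A) (k : hom Z B) : hom (dobj A) B :=
  iota (dobj A) ;; dag (ip _ _ _ (dag k) (dag h)) ;; iota_inv B.

End InnerProduct.

Record inner_product_category := InnerProductCategory {
  ipcat :> involutive_category;
  ip : forall A B Z : ipcat, hom A Z -> hom B Z -> hom A (dobj B);
  IP1 : forall (A B Z Y W : ipcat) (f : hom A Z) (g : hom B Z)
      (h : hom Y A) (k : hom W B),
    ip (h ;; f) (k ;; g) = h ;; ip f g ;; dag k;
  IP2a : forall (A B Z : ipcat) (f : hom A Z) (g : hom B Z),
    iota A ;; dual_ip ip (dag f) (dag g) = ip f g;
  IP2b : forall (A B Z : ipcat) (f : hom A Z) (g : hom B Z),
    iota B ;; dag (ip f g) = ip g f;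
  IP3 : forall (A B Z : ipcat) (f : hom A Z) (g : hom B Z) (h k : hom Z B),
    h ;; g = idm Z -> ip f g ;; dual_ip ip h k = f ;; k;
  IP4 : forall (A Y Z : ipcat) (f : hom A Y) (g : hom A Z) (h k : hom Z A),
    g ;; h = idm A -> dual_ip ip f g ;; ip h k = dag (k ;; f) }.

Arguments ip {i A B Z} f g.

Section InnerAdjoint.

Variable X : inner_product_category.

Definition is_inner_adjoint (A B : X) (f : hom A B) (g : hom B A) : Prop :=
  forall (Y Z : X) (x : hom Y A) (y : hom Z B), ip (x ;; f) y = ip x (y ;; g).

Let phi (A : X) : hom A (dobj A) := ip (idm A) (idm A).
Let phi_inv (A : X) : hom (dobj A) A := dual_ip (@ip X) (idm A) (idm A).

Let phiK A : phi A ;; phi_inv A = idm A.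
Proof. by rewrite /phi /phi_inv IP3 comp1m. Qed.

Let phi_invK A : phi_inv A ;; phi A = idm (dobj A).
Proof. by rewrite /phi /phi_inv IP4 comp1m // dag_id. Qed.

Let ipE (A B Z : X) (f : hom A Z) (g : hom B Z) :
  ip f g = f ;; phi Z ;; dag g.
Proof. by rewrite -IP1 !compm1. Qed.

Let dag_phi A : iota A ;; dag (phi A) = phi A.
Proof. exact: IP2b. Qed.

Lemma inner_adjoint_exists (A B : X) (f : hom A B) :
  {g : hom B A | unique (is_inner_adjoint f) g}.
Proof.
clearbody phi phi_inv.
pose g := phi B ;; dag f ;; phi_inv A.
have dag_phi_inv : dag (phi_inv A) = phi_inv A ;; iota A.
  rewrite -[LHS]comp1m -(phi_invK A) -dag_phi -!compA.
  by rewrite -dag_comp phi_invK !dag_id compm1.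
have g_dag : phi A ;; dag g = f ;; phi B.
  rewrite /g !dag_comp dag_phi_inv !compA phiK comp1m.
  by rewrite -iota_natural -compA dag_phi.
exists g; split=> [Y Z x y|g' g'P].
  by rewrite !ipE dag_comp compA -(compA x (phi A)) g_dag !compA.
have {}g'P := g'P _ _ (idm A) (idm B).
have eq_dag : dag g = dag g'.
  move: g'P; rewrite !ipE !comp1m dag_id compm1 -g_dag.
  by move=> /(f_equal (comp (phi_inv A))); rewrite !compA phi_invK !comp1m.
rewrite -(compm1 g) -(compm1 g') -(iotaK A) !compA !iota_natural.
by rewrite eq_dag.
Qed.

(** The inner adjoint of [f]: the unique map satisfying [is_inner_adjoint f]. *)
Definition inner_adjoint (A B : X) (f : hom A B) : hom B A :=
  proj1_sig (inner_adjoint_exists f).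

End InnerAdjoint.

(** [(X, star)] is a dagger category: [star] is an identity-on-objects
    contravariant functor which is its own inverse. *)
Record is_dagger_category (X : category)
    (star : forall A B : X, hom A B -> hom B A) : Prop := IsDaggerCategory {
  star_id : forall A : X, star A A (idm A) = idm A;
  star_comp : forall (A B C : X) (f : hom A B) (g : hom B C),
    star A C (f ;; g) = star B C g ;; star A B f;
  starK : forall (A B : X) (f : hom A B), star B A (star A B f) = f }.

(* Main.v *)
(** Each law holds because both sides are inner adjoints of the same map; for
    the involution law, [IP2b] shows that the inner adjoint relation is
    symmetric. *)
From mathcomp Require Import ssreflect.
Require Import Defs.

Local Open Scope cat_scope.

(** By [inner_adjoint_unique], each dagger law reduces to its right-hand side solving the defining
    equation of the adjoint on the left; no formula for $f^*$ is needed. *)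

Lemma inner_adjointP (X : inner_product_category) (A B : X) (f : hom A B) :
  is_inner_adjoint f (inner_adjoint f).
Proof. by rewrite /inner_adjoint; case: inner_adjoint_exists => g []. Qed.

Lemma inner_adjoint_unique (X : inner_product_category) (A B : X)
    (f : hom A B) (g : hom B A) :
  is_inner_adjoint f g -> inner_adjoint f = g.
Proof.
by rewrite /inner_adjoint; case: inner_adjoint_exists => h [_ /=]; apply.
Qed.

Lemma is_inner_adjoint_id (X : inner_product_category) (A : X) :
  is_inner_adjoint (idm A) (idm A).
Proof. by move=> Y Z x y; rewrite !compm1. Qed.

(** [g] crosses the inner product first, then [f], hence the reversed order. *)
Lemma is_inner_adjoint_comp (X : inner_product_category) (A B C : X)
    (f : hom A B) (f' : hom B A) (g : hom B C) (g' : hom C B) :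
  is_inner_adjoint f f' -> is_inner_adjoint g g' ->
  is_inner_adjoint (f ;; g) (g' ;; f').
Proof. by move=> fP gP Y Z x y; rewrite !compA gP fP. Qed.

(** Conjugate symmetry [IP2b] swaps the two arguments, the hypothesis moves [g] across as [f], and
    [IP2b] swaps back. *)
Lemma is_inner_adjoint_sym (X : inner_product_category) (A B : X)
    (f : hom A B) (g : hom B A) :
  is_inner_adjoint f g -> is_inner_adjoint g f.
Proof. by move=> fgP Y Z x y; rewrite -IP2b -fgP IP2b. Qed.

Theorem proposition4p11 (X : inner_product_category) :
  is_dagger_category (fun (A B : X) (f : hom A B) => inner_adjoint f).
Proof.
split=> [A|A B C f g|A B f]; apply: inner_adjoint_unique.
- exact: is_inner_adjoint_id.
- by apply: is_inner_adjoint_comp; apply: inner_adjointP.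
- exact/is_inner_adjoint_sym/inner_adjointP.
Qed.
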